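(* Let $1\le k\le n$, let $A\in\mathbb{R}^{n\times n}$ be symmetric positive definite, let $b\in\mathbb{R}^n$, and let $E\in\mathbb{R}^{n\times k}$ be such that $E^T\in\mathbb{R}^{k\times n}$ has Kruskal rank $k$. Put $$\tilde A=\begin{bmatrix} A & AE\\ E^T A & E^T A E\end{bmatrix},\qquad \tilde b=\begin{bmatrix} b\\ E^T b\end{bmatrix}.$$ Let $\mathcal F\subset[n]=\{1,\dots,n\}$ with $|\mathcal F|\le k$, let $\mathcal C=[n]\setminus\mathcal F$, and let $f\in\mathbb{R}^{|\mathcal F|}$. Let $\begin{bmatrix} c\\ r\end{bmatrix}$, with $c\in\mathbb{R}^{|\mathcal C|}$ and $r\in\mathbb{R}^k$, be any solution of the purified system $$\begin{bmatrix} A_{11} & Z_1\\ Z_1^T & R\end{bmatrix}\begin{bmatrix} c\\ r\end{bmatrix}=\begin{bmatrix} b_1\\ E^T b\end{bmatrix}-\begin{bmatrix} A_{12}\\ Z_2^T\end{bmatrix} f .$$ Then $\begin{bmatrix} c\\ f\\ r\end{bmatrix}$ is (up to the permutation of indices) a solution of the encoded system; that is, the vector $\tilde x\in\mathbb{R}^{n+k}$ with $\tilde x_{\mathcal C}=c$, $\tilde x_{\mathcal F}=f$ and $\tilde x_{\{n+1,\dots,n+k\}}=r$ satisfies $\tilde A\tilde x=\tilde b$.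
   Context: The Kruskal rank of a matrix is the largest number $k$ such that every subset of $k$ of its columns is linearly independent. Subscripts $1$ and $2$ refer to the index sets $\mathcal C$ (correct components) and $\mathcal F$ (faulty components) respectively: $A_{11}=A_{\mathcal C,\mathcal C}$, $A_{12}=A_{\mathcal C,\mathcal F}$, $A_{22}=A_{\mathcal F,\mathcal F}$ are submatrices of $A$; $E_1=E_{\mathcal C,:}$ and $E_2=E_{\mathcal F,:}$ are the row-submatrices of $E$; $b_1=b_{\mathcal C}$ and $b_2=b_{\mathcal F}$ are subvectors of $b$. Further, $Z_1=A_{11}E_1+A_{12}E_2$, $Z_2=A_{12}^T E_1+A_{22}E_2$, and $R=E^T A E$. For an index set $\mathcal S$, $\tilde x_{\mathcal S}$ denotes the subvector of $\tilde x$ with components indexed by $\mathcal S$ (in increasing order). *)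

(* Defs.v *)
From mathcomp Require Import all_boot all_order all_algebra.
From mathcomp Require Export reals.

Set Implicit Arguments.
Unset Strict Implicit.
Unset Printing Implicit Defensive.

Import GRing.Theory Num.Theory.
Local Open Scope ring_scope.

Definition spd (R : realType) (n : nat) (A : 'M[R]_n) : Prop :=
  A^T = A /\ forall x : 'cV[R]_n, x != 0 -> 0 < (x^T *m A *m x) 0 0.

(* Linear independence of an indexed family of columns: two equal columns with
   distinct indices are dependent. *)
Definition cols_free (R : realType) (m n : nat) (M : 'M[R]_(m, n))
    (S : {set 'I_n}) : bool :=
  free [seq col j M | j <- enum S].

(* The maximum ranges over t <= n only, since for t > n the condition on the
   t-element sets of columns is vacuous. *)
Definition kruskal_rank (R : realType) (m n : nat) (M : 'M[R]_(m, n)) : nat :=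
  \max_(t < n.+1 | [forall S : {set 'I_n}, (#|S| == t) ==> cols_free M S]) t.

(* The restrictions below list the selected indices in increasing order, as
   enum_val does for subsets of 'I_n. *)
Definition submat (R : realType) (m n : nat) (S : {set 'I_m}) (T : {set 'I_n})
    (M : 'M[R]_(m, n)) : 'M[R]_(#|S|, #|T|) :=
  mxsub (fun i : 'I_#|S| => enum_val i) (fun j : 'I_#|T| => enum_val j) M.

Definition subrows (R : realType) (m n : nat) (S : {set 'I_m})
    (M : 'M[R]_(m, n)) : 'M[R]_(#|S|, n) :=
  rowsub (fun i : 'I_#|S| => enum_val i) M.

Definition encoded_mx (R : realType) (n k : nat) (A : 'M[R]_n)
    (E : 'M[R]_(n, k)) : 'M[R]_(n + k) :=
  block_mx A (A *m E) (E^T *m A) (E^T *m A *m E).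

Definition encoded_rhs (R : realType) (n k : nat) (E : 'M[R]_(n, k))
    (b : 'cV[R]_n) : 'cV[R]_(n + k) :=
  col_mx b (E^T *m b).

Definition assembled (R : realType) (n k : nat) (F : {set 'I_n})
    (c : 'cV[R]_#|~: F|) (f : 'cV[R]_#|F|) (r : 'cV[R]_k)
    (x : 'cV[R]_(n + k)) : Prop :=
  [/\ subrows (~: F) (usubmx x) = c, subrows F (usubmx x) = f & dsubmx x = r].

(* Hence quantifying over all x with [assembled c f r x] amounts to naming the
   vector with these components. *)
Lemma assembled_exists_unique (R : realType) (n k : nat) (F : {set 'I_n})
    (c : 'cV[R]_#|~: F|) (f : 'cV[R]_#|F|) (r : 'cV[R]_k) :
  exists! x, assembled c f r x.
Proof.
pose g (S : {set 'I_n}) (v : 'cV[R]_#|S|) i : R :=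
  \sum_(j | enum_val j == i) v j 0.
have gE (S : {set 'I_n}) v j : @g S v (enum_val j) = v j 0.
  by rewrite /g (eq_bigl (pred1 j)) ?big_pred1_eq // => l; rewrite (inj_eq enum_val_inj).
have g0 (S : {set 'I_n}) v i : i \notin S -> @g S v i = 0.
  move=> iS; rewrite /g big1 // => j /eqP ji; case/negP: iS; rewrite -ji.
  exact: enum_valP.
exists (col_mx (\col_i (g _ c i + g _ f i)) r); split.
- split; rewrite ?col_mxKu ?col_mxKd //; apply/colP=> j; rewrite !mxE gE.
  + by rewrite g0 ?addr0 //; have := enum_valP j; rewrite inE.
  + by rewrite g0 ?add0r // inE negbK enum_valP.
- move=> y [yc yf yr]; rewrite -[y]vsubmxK yr; congr col_mx; apply/colP=> i.
  rewrite mxE; case: (boolP (i \in F)) => iF.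
  + rewrite (g0 _ c) ?inE ?iF // add0r -(enum_rankK_in iF iF) gE -yf !mxE.
    by rewrite enum_rankK_in.
  + have iC : i \in ~: F by rewrite inE.
    rewrite (g0 _ f) // addr0 -(enum_rankK_in iC iC) gE -yc !mxE.
    by rewrite enum_rankK_in.
Qed.

(* Main.v *)
Require Import Defs.
From mathcomp Require Import all_boot all_order all_algebra reals.

Set Implicit Arguments.
Unset Strict Implicit.
Unset Printing Implicit Defensive.

Import GRing.Theory Num.Theory.
Local Open Scope ring_scope.

(** Split the solution as [x = col_mx y r] and consider the residual
[u = A *m (y + E *m r) - b] of the first block row of the encoded system.  Since
[encoded_mx A E] and [encoded_rhs E b] both have the shape of a block followed by
[E^T] times that block, it suffices to show [u = 0].

Cutting matrix products along [~: F] and [F] ([mulmx_splitC]) identifies [Z1]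
and [Z2] with the row restrictions of [A *m E], the latter by symmetry of [A].
Hence the first block of the purified system says that [u] vanishes on [~: F], and
its second block says [E^T *m u = 0].  So [u] encodes a linear relation between
the columns of [E^T] indexed by [F].  At most [k] columns are involved, so the
Kruskal rank hypothesis leaves only the trivial relation
([kruskal_rank_mulmx_eq0]). *)

Lemma exists_superset_card (T : finType) (A : {set T}) (t : nat) :
  (#|A| <= t <= #|T|)%N -> exists2 S : {set T}, A \subset S & #|S| = t.
Proof.
elim: t => [|t IHt] /andP[At tT].
  by exists A => //; apply/eqP; rewrite -leqn0.
move: At; rewrite leq_eqVlt ltnS => /predU1P[At|At]; first by exists A.
have /IHt[S AS cS] : (#|A| <= t <= #|T|)%N by rewrite At ltnW.
have /card_gt0P[a aS] : (0 < #|~: S|)%N.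
  by rewrite -(ltn_add2l #|S|) cardsC addn0 cS.
exists (a |: S); first exact: subset_trans AS (subsetUr _ _).
by rewrite cardsU1 cS; move: aS; rewrite inE => ->.
Qed.

(** The maximum defining the rank is attained: the empty set of columns is free,
so that the range of the maximum is inhabited by [t = 0]. *)
Lemma kruskal_rank_cols_free (R : realType) (m n : nat) (M : 'M[R]_(m, n))
    (S : {set 'I_n}) :
  #|S| = kruskal_rank M -> cols_free M S.
Proof.
pose P (t : 'I_n.+1) :=
  [forall S' : {set 'I_n}, (#|S'| == t) ==> cols_free M S'].
have P0 : P ord0.
  apply/forallP=> S'; apply/implyP; rewrite cards_eq0 => /eqP->.
  by rewrite /cols_free enum_set0 nil_free.
rewrite /kruskal_rank (bigmax_eq_arg ord0 P0).
case: arg_maxnP => // t /forallP/(_ S)/implyP Pt _ cS.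
by apply: Pt; rewrite cS.
Qed.

Lemma cols_free_mulmx_eq0 (R : realType) (m n : nat) (M : 'M[R]_(m, n))
    (S : {set 'I_n}) (u : 'cV[R]_n) :
  cols_free M S -> (forall i, i \notin S -> u i 0 = 0) ->
  M *m u = 0 -> u = 0.
Proof.
move=> freeS uS Mu0.
have /freeP freeX : free [tuple of [seq col j M | j <- enum_tuple S]] by [].
have u_val (j : 'I_#|S|) : u (enum_val j) 0 = 0.
  move: j; apply: freeX.
  transitivity (\sum_(j < #|S|) u (enum_val j) 0 *: col (enum_val j) M).
    apply: eq_bigr => j _; rewrite (nth_map (enum_val j)) -?cardE //.
    by rewrite -enum_val_nth.
  rewrite -(big_enum_val (fun i => u i 0 *: col i M)) /=.
  (* The entries of [u] outside [S] vanish, so this sum is the whole of [M *m u]. *)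
  rewrite -{}[RHS]Mu0; apply/colP=> l; rewrite summxE mxE.
  rewrite [RHS](bigID [in S]) /= [X in _ + X]big1 ?addr0; last first.
    by move=> i /uS->; rewrite mulr0.
  by apply: eq_bigr => i _; rewrite !mxE mulrC.
apply/colP=> i; rewrite mxE; have [iS|/uS//] := boolP (i \in S).
by rewrite -(enum_rankK_in iS iS) u_val.
Qed.

(** The rank speaks of sets of exactly [kruskal_rank M] columns, so the support
bound [F] is first enlarged to such a set; the bound by [n] leaves room for that. *)
Lemma kruskal_rank_mulmx_eq0 (R : realType) (m n : nat) (M : 'M[R]_(m, n))
    (F : {set 'I_n}) (u : 'cV[R]_n) :
  (#|F| <= kruskal_rank M <= n)%N -> subrows (~: F) u = 0 ->
  M *m u = 0 -> u = 0.
Proof.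
have := @exists_superset_card _ F (kruskal_rank M).
rewrite card_ord => /[apply] -[S FS cS] uF.
apply: cols_free_mulmx_eq0 (kruskal_rank_cols_free cS) _ => i iS.
have iC : i \in ~: F by rewrite inE; apply: contra iS => /(subsetP FS).
by have /colP/(_ (enum_rank_in iC i)) := uF; rewrite !mxE enum_rankK_in.
Qed.

Lemma mulmx_splitC (R : realType) (m n p : nat) (F : {set 'I_n})
    (M : 'M[R]_(m, n)) (N : 'M[R]_(n, p)) :
  M *m N = colsub (fun j : 'I_#|~: F| => enum_val j) M *m subrows (~: F) N
         + colsub (fun j : 'I_#|F| => enum_val j) M *m subrows F N.
Proof.
apply/matrixP=> i j; rewrite !mxE (bigID [in F]) [LHS]addrC /=; congr (_ + _).
  rewrite (eq_bigl [in ~: F]) => [|l]; last by rewrite !inE.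
  by rewrite big_enum_val; apply: eq_bigr => l _; rewrite !mxE.
by rewrite big_enum_val; apply: eq_bigr => l _; rewrite !mxE.
Qed.

Lemma subrows_mulmx_splitC (R : realType) (m n p : nat) (S : {set 'I_m})
    (F : {set 'I_n}) (M : 'M[R]_(m, n)) (N : 'M[R]_(n, p)) :
  subrows S (M *m N)
  = submat S (~: F) M *m subrows (~: F) N + submat S F M *m subrows F N.
Proof.
rewrite /subrows -mul_rowsub_mx (mulmx_splitC F).
by congr (_ + _); congr (_ *m _); apply/matrixP=> i j; rewrite !mxE.
Qed.

Lemma trmx_mul_splitC (R : realType) (m n p : nat) (F : {set 'I_n})
    (M : 'M[R]_(n, m)) (N : 'M[R]_(n, p)) :
  M^T *m N = (subrows (~: F) M)^T *m subrows (~: F) N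
           + (subrows F M)^T *m subrows F N.
Proof.
rewrite (mulmx_splitC F).
by congr (_ + _); congr (_ *m _); apply/matrixP=> i j; rewrite !mxE.
Qed.

Theorem proposition5 (R : realType) (n k : nat) (hk : (1 <= k <= n)%N)
    (A : 'M[R]_n) (hA : spd A) (b : 'cV[R]_n)
    (E : 'M[R]_(n, k)) (hE : kruskal_rank E^T = k)
    (F : {set 'I_n}) (hF : (#|F| <= k)%N)
    (f : 'cV[R]_#|F|) (c : 'cV[R]_#|~: F|) (r : 'cV[R]_k) :
  let C := ~: F in
  let A11 := submat C C A in
  let A12 := submat C F A in
  let A22 := submat F F A in
  let E1 := subrows C E in
  let E2 := subrows F E in
  let Z1 := A11 *m E1 + A12 *m E2 in
  let Z2 := A12^T *m E1 + A22 *m E2 in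
  let Rk := E^T *m A *m E in
  block_mx A11 Z1 Z1^T Rk *m col_mx c r
    = col_mx (subrows C b) (E^T *m b) - col_mx A12 Z2^T *m f ->
  forall x : 'cV[R]_(n + k), assembled c f r x ->
    encoded_mx A E *m x = encoded_rhs E b.
Proof.
move=> C A11 A12 A22 E1 E2 Z1 Z2 Rk sys x [].
rewrite -[x]vsubmxK col_mxKu col_mxKd.
move: (usubmx x) (dsubmx x) => y _ yC yF -> {x}.
have [A_sym _] := hA.
have Z1E : Z1 = subrows C (A *m E) by rewrite (subrows_mulmx_splitC C F).
have Z2E : Z2 = subrows F (A *m E).
  rewrite (subrows_mulmx_splitC F F); congr (_ *m _ + _).
  by rewrite -[in RHS]A_sym; apply/matrixP=> i j; rewrite !mxE.
move: sys; rewrite mul_block_col mul_col_mx opp_col_mx add_col_mx.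
case/eq_col_mx => sysC sysE.
pose u := A *m y + A *m E *m r - b.
have uC : subrows C u = 0.
  have subrowsD p (M N : 'M[R]_(n, p)) :
    subrows C (M + N) = subrows C M + subrows C N.
    by apply/matrixP=> i j; rewrite !mxE.
  have subrowsN p (M : 'M[R]_(n, p)) : subrows C (- M) = - subrows C M.
    by apply/matrixP=> i j; rewrite !mxE.
  rewrite /u !subrowsD subrowsN (subrows_mulmx_splitC C F) yC yF.
  have -> : subrows C (A *m E *m r) = Z1 *m r.
    by rewrite Z1E /subrows mul_rowsub_mx.
  by rewrite (addrAC (A11 *m c)) sysC subrK subrr.
have Eu0 : E^T *m u = 0.
  rewrite /u mulmxBr mulmxDr !mulmxA.
  have -> : E^T *m A *m y = Z1^T *m c + Z2^T *m f.
    rewrite -[X in E^T *m X]A_sym -trmx_mul (trmx_mul_splitC F) yC yF.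
    by rewrite Z1E Z2E.
  by rewrite (addrAC (Z1^T *m c)) sysE subrK subrr.
have u0 : u = 0.
  case/andP: hk => _ kn.
  by apply: kruskal_rank_mulmx_eq0 uC Eu0; rewrite hE hF.
have Ay : A *m y + A *m E *m r = b by apply/eqP; rewrite -subr_eq0 -/u u0.
rewrite /encoded_mx /encoded_rhs mul_block_col Ay; congr col_mx.
by rewrite -Ay mulmxDr !mulmxA.
Qed.
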